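(* Let $G$ be a countable group acting almost freely by isometries on a metric space $(X,\mathrm{dist})$, let $x_0\in X$ and let $L(g)=\mathrm{dist}(x_0,g\cdot x_0)$. Let $T_1,\dots,T_m\subseteq X^3$ be $G$-invariant subsets each of which satisfies property RD. If $G$ has the relative centroid property with respect to $T_1,\dots,T_m$ and the length function $L$ is proper, then $G$ has property RD with respect to $L$.
   Context: All polynomials are assumed to have non-negative coefficients. Length function: a map $L\colon G\to[0,\infty)$ with $L(gh)\le L(g)+L(h)$, $L(g)=L(g^{-1})$, $L(1)=0$; it is proper if $\{g: L(g)\le r\}$ is finite for every $r>0$. Property RD for $G$: for finitely supported $\phi,\psi\colon G\to[0,\infty)$ put $\|\phi\|=\sqrt{\sum_{g}\phi(g)^2}$, $\phi*\psi(k)=\sum_{g}\phi(g)\psi(g^{-1}k)$, $\mathrm{prop}(\phi)=\max\{L(g): \phi(g)\ne 0\}$. $G$ has property RD with respect to $L$ if there is a polynomial $P$ such that for every $r>0$ and all finitely supported $\phi,\psi\colon G\to[0,\infty)$ with $\mathrm{prop}(\phi)\le r$ one has $\|\phi*\psi\|^2\le P(r)\|\phi\|^2\|\psi\|^2$. Almost free action: the diameters (with respect to the pseudo-distance $(a,b)\mapsto L(a^{-1}b)$ on $G$) of all point stabilizers are uniformly bounded from above. Property RD for a $G$-invariant $T\subseteq X^3$ ($G$ acts diagonally on $X^2$ and $X^3$): a function $\phi\colon X^2\to[0,\infty)$ is $G$-invariant if $\phi(g\cdot x,g\cdot y)=\phi(x,y)$ for all $g,x,y$; it then induces a function on $X^2/G$,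 also denoted $\phi$. It has finite support if its support consists of finitely many $G$-orbits; its norm is given by $\|\phi\|^2=\sum_{\mathbf{x}\in X^2/G}\phi(\mathbf{x})^2$; its propagation $\mathrm{prop}(\phi)$ is the maximum of $\mathrm{dist}(x,y)$ over $(x,y)$ in its support. Put $\phi*_T\psi(x,y)=\sum_{z\in X,\ (x,z,y)\in T}\phi(x,z)\psi(z,y)$. $T$ satisfies property RD if there is a polynomial $P$ such that for every $r$ and every two $G$-invariant functions $\phi,\psi\colon X^2\to[0,\infty)$ with finite support and $\mathrm{prop}(\phi)\le r$ one has $\|\phi*_T\psi\|^2\le P(r)\|\phi\|^2\|\psi\|^2$. Relative centroid property: $G$ has the relative centroid property with respect to $G$-invariant $T_1,\dots,T_m\subseteq X^3$ if there are a map $\mathfrak{rc}\colon G^2\to\bigcup_{i=1}^m T_i$ and a polynomial $P$ such that for all $r>0$: ($rc_1$) for every $k\in G$ the number of pairs $(\alpha,\gamma)\in X^2$ such that $\mathfrak{rc}(g,k)=(\alpha,\beta,\gamma)$ for some $g\in G$ with $L(g)\le r$ and some $\beta\in X$ is at most $P(r)$; ($rc_2$) for every $g\in G$ the number of pairs $(\alpha,\beta)\in X^2$ such that $\mathfrak{rc}(g,k)=(\alpha,\beta,\gamma)$ for some $k\in G$, $\gamma\in X$ is at most $P(L(g))$; ($rc_3$) for every $h\in G$ the number of pairs in $X^2$ of the form $g^{-1}\cdot(\beta,\gamma)$, where $g\in G$, $L(g)\le r$ and $\mathfrak{rc}(g,gh)=(\alpha,\beta,\gamma)$ for some $\alpha\in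 X$, is at most $P(r)$; ($rc_4$) for all $g,k\in G$, if $(\alpha,\beta,\gamma)=\mathfrak{rc}(g,k)$, then $\mathrm{dist}(\alpha,\beta)\le P(L(g))$, $\mathrm{dist}(\alpha,\gamma)\le P(L(k))$, $\mathrm{dist}(\beta,\gamma)\le P(L(g^{-1}k))$. *)

(* Defs.v *)
From HB Require Import structures.
From mathcomp Require Import all_boot all_order all_algebra.
From mathcomp Require Import all_classical all_reals all_analysis.

Set Implicit Arguments.
Unset Strict Implicit.
Unset Printing Implicit Defensive.

Import Order.TTheory GRing.Theory Num.Theory.
Local Open Scope classical_set_scope.
Local Open Scope ring_scope.
Local Open Scope quotient_scope.

(* The groups considered are possibly infinite, so the actions of
   mathcomp.fingroup.action do not apply. *)
Record isomAction (R : realType) (G : groupType) (X : metricType R) := IsomAction {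
  iact :> G -> X -> X;
  iact1 : forall x, iact 1%g x = x;
  iactM : forall g h x, iact (g * h)%g x = iact g (iact h x);
  iact_isom : forall g x y, mdist (iact g x) (iact g y) = mdist x y
}.

Section GroupRD.
Variables (R : realType) (G : groupType).
Implicit Types (L : G -> R) (phi psi : G -> R).

Definition proper_length L := forall r : R, 0 < r -> finite_set [set g | L g <= r].

(* The sums below are [fsbig] sums, which are meaningful for finitely
   supported functions only. *)
Definition finsupp phi := finite_set [set g | phi g != 0].

Definition l2norm phi : R := Num.sqrt (\sum_(g \in [set: G]) phi g ^+ 2).

Definition convol phi psi : G -> R :=
  fun k => \sum_(g \in [set: G]) phi g * psi (g^-1 * k)%g.

(* The supremum of a nonempty finite set is its maximum; for phi = 0 it is 0. *)
Definition propagation L phi : R := sup [set L g | g in [set g | phi g != 0]].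

Definition property_RD L := exists2 P : {poly R}, P \is a polyOver Num.nneg &
  forall (r : R), 0 < r -> forall phi psi : G -> R,
    (forall g, 0 <= phi g) -> (forall g, 0 <= psi g) ->
    finsupp phi -> finsupp psi -> propagation L phi <= r ->
    l2norm (convol phi psi) ^+ 2 <= P.[r] * l2norm phi ^+ 2 * l2norm psi ^+ 2.

Definition diam L (A : set G) : \bar R :=
  ereal_sup [set (L (p.1^-1 * p.2)%g)%:E | p in A `*` A].

End GroupRD.

Section ActionRD.
Variables (R : realType) (G : groupType) (X : metricType R) (a : isomAction G X).

Definition orbit_length (x0 : X) (g : G) : R := mdist x0 (a g x0).

Definition stabilizer (x : X) : set G := [set g | a g x = x].

Definition almost_free (L : G -> R) :=
  exists D : R, forall x, (diam L (stabilizer x) <= D%:E)%E.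

Definition act2 (g : G) (p : X * X) : X * X := (a g p.1, a g p.2).

Definition orbit2_rel : rel (X * X) := fun p q => `[< exists g, q = act2 g p >].

Lemma orbit2_refl : reflexive orbit2_rel.
Proof. by move=> [x y]; apply/asboolP; exists 1%g; rewrite /act2 !iact1. Qed.

Lemma orbit2_sym : symmetric orbit2_rel.
Proof.
suff H p q : orbit2_rel p q -> orbit2_rel q p by move=> p q; apply/idP/idP; exact: H.
move=> /asboolP[g ->]; apply/asboolP; exists g^-1%g.
by rewrite /act2 /= -!iactM mulVg !iact1; case: p.
Qed.

Lemma orbit2_trans : transitive orbit2_rel.
Proof.
move=> q p s /asboolP[g ->] /asboolP[h ->]; apply/asboolP; exists (h * g)%g.
by rewrite /act2 !iactM.
Qed.

Canonical orbit2_equiv :=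
  EquivRel orbit2_rel orbit2_refl orbit2_sym orbit2_trans.

(* X^2 / G *)
Definition orbit2 := {eq_quot orbit2_rel}.

Definition invariant2 (phi : X * X -> R) := forall g p, phi (act2 g p) = phi p.

Definition invariant3 (T : set (X * X * X)) :=
  forall g x y z, T (x, y, z) -> T (a g x, a g y, a g z).

Definition finsupp2 (phi : X * X -> R) :=
  finite_set [set \pi_orbit2 p | p in [set p | phi p != 0]].

(* Sums are taken in [0, +oo], since [convol2] may involve infinite sums for a
   general action. A G-invariant f has the value [f (repr o)] on the orbit o. *)
Definition sqnorm2 (f : X * X -> \bar R) : \bar R :=
  \esum_(o in [set: orbit2]) (f (repr o) ^+ 2)%E.

Definition propagation2 (phi : X * X -> R) : R :=
  sup [set mdist p.1 p.2 | p in [set p | phi p != 0]].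

Definition convol2 (T : set (X * X * X)) (phi psi : X * X -> R) : X * X -> \bar R :=
  fun p => \esum_(z in [set z | T (p.1, z, p.2)]) (phi (p.1, z) * psi (z, p.2))%:E.

Definition property_RD3 (T : set (X * X * X)) :=
  exists2 P : {poly R}, P \is a polyOver Num.nneg &
  forall (r : R) (phi psi : X * X -> R),
    (forall p, 0 <= phi p) -> (forall p, 0 <= psi p) ->
    invariant2 phi -> invariant2 psi -> finsupp2 phi -> finsupp2 psi ->
    propagation2 phi <= r ->
    (sqnorm2 (convol2 T phi psi) <=
       P.[r]%:E * sqnorm2 (EFin \o phi) * sqnorm2 (EFin \o psi))%E.

(* [counting A] is the cardinality of A, +oo if A is infinite. *)
Definition relative_centroid (L : G -> R) (m : nat) (T : 'I_m -> set (X * X * X)) :=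
  exists (rc : G * G -> X * X * X) (P : {poly R}),
  [/\ P \is a polyOver Num.nneg,
      forall gk, (\bigcup_i T i) (rc gk) &
      forall r : R, 0 < r ->
      [/\ forall k : G,
            (counting [set p : X * X | exists g be,
               (L g <= r)%R /\ rc (g, k) = (p.1, be, p.2)] <= P.[r]%:E)%E,
          forall g : G,
            (counting [set p : X * X | exists k ga,
               rc (g, k) = (p.1, p.2, ga)] <= P.[L g]%:E)%E,
          forall h : G,
            (counting [set p : X * X | exists g al be ga,
               [/\ (L g <= r)%R, rc (g, (g * h)%g) = (al, be, ga) &
                   p = act2 g^-1%g (be, ga)]] <= P.[r]%:E)%E &
          forall g k al be ga, rc (g, k) = (al, be, ga) ->
            [/\ mdist al be <= P.[L g], mdist al ga <= P.[L k] &
                mdist be ga <= P.[L (g^-1 * k)%g]]]].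

End ActionRD.

(* Main.v *)
Require Import Defs.
From HB Require Import structures.
From mathcomp Require Import all_boot all_order all_algebra.
From mathcomp Require Import all_classical all_reals all_analysis.
From mathcomp Require Import ring lra.
Import Order.TTheory GRing.Theory Num.Theory.
Local Open Scope classical_set_scope.
Local Open Scope ring_scope.

(** Let [F k g = phi g * psi (g^-1 k)], so that [(phi * psi) k] is the sum of
    [F k g] over [g], and sort the elements [g] by the value
    [(al, be, ga) = rc (g, k)].  If [L g <= r], the outer pair [(al, ga)] takes
    at most [P(r)] values for each [k], so Cauchy-Schwarz
    ([esum_sqr_le_fibers]) gives
      [(phi * psi)(k)^2 <= P(r) * sum over (al, ga) of D_k(al, ga)^2],
    where [D_k(al, ga)] sums [F k g] over the [g] whose outer pair is
    [(al, ga)].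

    The sum over [k] of the right-hand side is to be compared with a
    convolution of invariant functions on [X^2].  These are obtained from [phi]
    by giving the pair [(al, be)] the mass of the [phi g ^ 2] such that
    [(al, be)] begins [rc (g, k)] for some [k], from [psi] by giving the pair
    [g^-1 (be, ga)] the mass of the [psi h ^ 2] such that
    [rc (g, g h) = (al, be, ga)] and [L g <= r], and in both cases by summing
    over the translates of a pair and taking a square root; call them [Phi] and
    [Psi] (see [periodized]).
    A pair of [X^2] is a translate [x p] of the representative [p] of its
    orbit, in at least one way, so it suffices to bound, for [p = (al, ga)],
    the sum of [D_k(x p)^2] over all [x] and [k].  Now [D_k(x p)] is the sum
    over [be] of [v_be(x, k)], the part of [D_k(x p)] coming from the middle
    point [x be].  By Cauchy-Schwarz the norm of [v_be] in [l^2(G x G)] is at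
    most [Phi(al, be) * Psi(be, ga)]: with [x] and [k] both free, the factors
    [phi] and [psi] are summed over independent translates
    ([centroid_fiber_le]).  The triangle inequality in [l^2(G x G)] then bounds
    the norm of the sum over [be] by [(Phi *_T Psi)(al, ga)]
    ([centroid_outer_le]).  Summing over the orbits, [convol_le_sqnorm2] bounds
    [||phi * psi||^2] by [P(r) ||Phi *_T Psi||^2], to which property RD of [T]
    applies, the propagation of [Phi] being at most [P(r)].

    Finally [||Phi||^2 <= N P(r) ||phi||^2], and likewise for [Psi], where [N]
    bounds the order of the stabilizers: a pair is a translate of the
    representative of its orbit in at most [N] ways ([esum_orbits_le]).  The
    bound [N] exists because stabilizers of bounded diameter lie in a single
    ball of [L], which is finite as [L] is proper.

    Several sets [T_i] reduce to one, since property RD is stable under finite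
    unions ([property_RD3_bigcup]) and the centroid map only sees the union.

    All the sums of nonnegative terms are taken in [[0, +oo]], where they can
    be exchanged and reindexed freely, also over uncountable [X]. *)

Set Implicit Arguments.
Unset Strict Implicit.
Unset Printing Implicit Defensive.

Local Notation "\esum_ i F" := (esum [set: _] (fun i => F%E))
  (at level 41, i binder, F at level 41) : ereal_scope.

(** * Sums of nonnegative extended reals *)

Section Esum.
Local Open Scope ereal_scope.
Variable R : realType.

Section OneIndex.
Variable I : choiceType.
Implicit Types (f g : I -> \bar R) (A : set I).

Lemma esumT_ge0 f : (forall i, 0 <= f i) -> 0 <= \esum_ i f i.
Proof. by move=> f0; apply: esum_ge0. Qed.

Lemma le_esumT f g : (forall i, f i <= g i) -> \esum_ i f i <= \esum_ i g i.
Proof. by move=> fg; apply: le_esum. Qed.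

Lemma eq_esumT f g : (forall i, f i = g i) -> \esum_ i f i = \esum_ i g i.
Proof. by move=> fg; apply: eq_esum. Qed.

Lemma esum_term f i : f i <= \esum_ j f j.
Proof.
apply: esum_ge; exists [set i]; last by rewrite fsbig_set1.
by split => //; exact: finite_set1.
Qed.

Lemma esum_if A f :
  \esum_(i in A) f i = \esum_ i (if `[< A i >] then f i else 0).
Proof.
rewrite esum_mkcond; apply: eq_esumT => i.
by rewrite (_ : (i \in A) = `[< A i >])//; apply/idP/asboolP; rewrite inE.
Qed.

Lemma esum_delta f i : 0 <= f i -> \esum_ j (if j == i then f j else 0) = f i.
Proof.
move=> fi0; rewrite -[RHS](@esum_set1 _ _ i f)// [RHS]esum_if.
apply: eq_esumT => j.
by congr (if _ then _ else _); apply/eqP/asboolP.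
Qed.

Lemma esum_counting A : finite_set A ->
  \esum_ i (if `[< A i >] then 1%:E else 0) = @counting _ R A.
Proof.
move=> finA; rewrite -(@esum_if A (fun=> 1%:E)) /counting asboolT//.
rewrite esum_fset// fsbig_finite//.
by rewrite sumEFin/= big_const_seq count_predT iter_addr_0.
Qed.

Lemma esum_counting_le A :
  \esum_ i (if `[< A i >] then 1%:E else 0) <= @counting _ R A.
Proof.
have [/esum_counting->//|infA] := pselect (finite_set A).
by rewrite /counting asboolF// leey.
Qed.

Let esumZl_le (c : \bar R) f : 0 <= c -> (forall i, 0 <= f i) ->
  \esum_ i (c * f i) <= c * \esum_ i f i.
Proof.
move=> c0 f0; apply: ge_ereal_sup => _ [F [finF _] <-].
rewrite -ge0_mule_fsumr// lee_wpmul2l//.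
by apply: ereal_sup_ubound; exists F.
Qed.

(** The hard inequality for a finite nonzero [c] is the easy one for [c^-1]; for
    [c = +oo], one positive term makes both sides infinite. *)
Lemma esumZl (c : \bar R) f : 0 <= c -> (forall i, 0 <= f i) ->
  \esum_ i (c * f i) = c * \esum_ i f i.
Proof.
move=> c0 f0; apply/eqP; rewrite eq_le esumZl_le//=.
have [->|cn0] := eqVneq c 0.
  by rewrite mul0e esumT_ge0// => i; rewrite mul0e.
case: c c0 cn0 => [c||//]; rewrite ?lee_fin ?eqe => c0 cn0; last first.
  have [allz|/existsNP[i /eqP fi]] := pselect (forall i, f i = 0).
    by rewrite esum1// mule0 esumT_ge0// => i; rewrite allz mule0.
  apply: le_trans (leey _) _; apply: le_trans (esum_term _ i).
  by rewrite gt0_mulye// lt_neqAle eq_sym fi f0.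
have cV : (0 < c^-1)%R by rewrite invr_gt0 lt_neqAle eq_sym cn0.
have := @esumZl_le c^-1%:E (fun i => c%:E * f i).
rewrite lee_fin => /(_ (ltW cV)) h.
have {}h := h (fun i => mule_ge0 (_ : 0 <= c%:E) (f0 i)).
rewrite -(@lee_pmul2l _ c^-1%:E)// muleA -EFinM mulVf// mul1e.
apply: le_trans (h _); last by rewrite lee_fin.
by apply: le_esumT => i; rewrite muleA -EFinM mulVf// mul1e.
Qed.

Lemma esumZr (c : \bar R) f : 0 <= c -> (forall i, 0 <= f i) ->
  \esum_ i (f i * c) = (\esum_ i f i) * c.
Proof.
move=> c0 f0; rewrite muleC -esumZl//.
by apply: eq_esumT => i; rewrite muleC.
Qed.

End OneIndex.

Section TwoIndices.
Variables I J : choiceType.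

Lemma esum_bij (h : I -> J) (f : J -> \bar R) : bijective h ->
  \esum_ i f (h i) = \esum_ j f j.
Proof.
by move=> bh; rewrite -(reindex_esum [set: I] [set: J] h)// setTT_bijective.
Qed.

Lemma esum_pair (f : I -> J -> \bar R) : (forall i j, 0 <= f i j) ->
  \esum_ i \esum_ j f i j = \esum_ z f z.1 z.2.
Proof.
move=> f0; rewrite (@esum_esum _ _ _ [set: I] (fun=> [set: J]))//.
by congr esum; apply/seteqP; split.
Qed.

End TwoIndices.

Lemma esum_exchange (I J : choiceType) (f : I -> J -> \bar R) :
  (forall i j, 0 <= f i j) ->
  \esum_ i \esum_ j f i j = \esum_ j \esum_ i f i j.
Proof.
move=> f0; rewrite !esum_pair//.
rewrite -(@esum_bij (J * I)%type (I * J)%type (fun z => (z.2, z.1)))//.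
by exists (fun z => (z.2, z.1)) => -[].
Qed.

Lemma esum_fiber (I J : choiceType) (h : I -> J) (f : I -> \bar R) :
  (forall i, 0 <= f i) ->
  \esum_ i f i = \esum_ j \esum_ i (if h i == j then f i else 0).
Proof.
move=> f0; rewrite esum_exchange; last by move=> j i; case: ifP.
apply: eq_esumT => i; rewrite -[LHS](@esum_delta _ (fun=> f i) (h i))//.
by apply: eq_esumT => j; rewrite eq_sym.
Qed.

Lemma esumM (I J : choiceType) (f : I -> \bar R) (g : J -> \bar R) :
  (forall i, 0 <= f i) -> (forall j, 0 <= g j) ->
  (\esum_ i f i) * (\esum_ j g j) = \esum_ i \esum_ j (f i * g j).
Proof.
move=> f0 g0; rewrite -esumZr// ?esumT_ge0//.
by apply: eq_esumT => i; rewrite esumZl.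
Qed.

Lemma lee_mul_sqr (x y : \bar R) : 0 <= x -> 0 <= y ->
  x * y + x * y <= x ^+ 2 + y ^+ 2.
Proof.
move=> x0 y0; case: (eqVneq x +oo) => [->|xoo].
  rewrite [+oo ^+ 2]expe2 mulyy addye ?leey//.
  by rewrite gt_eqF// (lt_le_trans _ (sqre_ge0 _)).
case: (eqVneq y +oo) => [->|yoo].
  rewrite [+oo ^+ 2]expe2 mulyy addey ?leey//.
  by rewrite gt_eqF// (lt_le_trans _ (sqre_ge0 _)).
case: x y x0 y0 xoo yoo => [x||] [y||]//; rewrite !lee_fin => x0 y0 _ _.
by have := sqr_ge0 (x - y)%R; nra.
Qed.

(** Twice the square of the left-hand sum is the double sum of
    [2 (f i * g j) (f j * g i)], which the arithmetic-geometric inequality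
    bounds term by term; each of the two resulting double sums is the product on
    the right.  This needs no division, so infinite sums are not special. *)
Lemma esum_cauchy_schwarz (I : choiceType) (f g : I -> \bar R) :
  (forall i, 0 <= f i) -> (forall i, 0 <= g i) ->
  (\esum_ i (f i * g i)) ^+ 2 <= (\esum_ i f i ^+ 2) * (\esum_ i g i ^+ 2).
Proof.
move=> f0 g0.
have fg0 i j : 0 <= f i * g j by exact: mule_ge0.
have sq0 (h : I -> \bar R) i : 0 <= h i ^+ 2 by exact: sqre_ge0.
set A := \esum_ i _ ^+ 2; set B := \esum_ i _ ^+ 2; set S := \esum_ i _.
have AB : A * B = \esum_ i \esum_ j (f i * g j) ^+ 2.
  rewrite esumM//; apply: eq_esumT => i; apply: eq_esumT => j.
  by rewrite !expe2 muleACA.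
have SS : S ^+ 2 = \esum_ i \esum_ j ((f i * g j) * (f j * g i)).
  rewrite expe2 esumM//; apply: eq_esumT => i; apply: eq_esumT => j.
  by rewrite muleACA [RHS]muleACA [g j * g i]muleC.
have twice : S ^+ 2 + S ^+ 2 <= A * B + A * B.
  have BA : A * B = \esum_ i \esum_ j (f j * g i) ^+ 2.
    by rewrite AB esum_exchange // => i j; exact: sqre_ge0.
  rewrite {1}AB BA SS -!esumD => [|i _|i _|i _|i _]; last 4 first.
  all: try by apply: esumT_ge0 => j; rewrite ?mule_ge0 ?sqre_ge0.
  apply: le_esumT => i; rewrite -!esumD => [|j _|j _|j _|j _]; last 4 first.
  all: try by rewrite ?mule_ge0 ?sqre_ge0.
  by apply: le_esumT => j; exact: lee_mul_sqr.
have double (x : \bar R) : x + x = 2%:E * x.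
  by rewrite -[in LHS](mul1e x) -ge0_muleDl// -EFinD.
by move: twice; rewrite !double lee_pmul2l// lte_fin.
Qed.

(** The triangle inequality for the [l^2] norm, for a family of vectors [v i]
    with norms at most [c i]: expand both squares into double sums over
    [(i, i')] and compare the inner product of [v i] and [v i'] with
    [c i * c i']. *)
Lemma esum_minkowski (I J : choiceType) (v : I -> J -> \bar R)
    (c : I -> \bar R) :
  (forall i j, 0 <= v i j) -> (forall i, 0 <= c i) ->
  (forall i, \esum_ j v i j ^+ 2 <= c i ^+ 2) ->
  \esum_ j (\esum_ i v i j) ^+ 2 <= (\esum_ i c i) ^+ 2.
Proof.
move=> v0 c0 vc.
have vv0 i i' j : 0 <= v i j * v i' j by exact: mule_ge0.
rewrite expe2 esumM// (_ : \esum_ j _ =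
    \esum_ i \esum_ i' \esum_ j (v i j * v i' j)).
  apply: le_esumT => i; apply: le_esumT => i'.
  rewrite -lee_sqr ?mule_ge0 ?esumT_ge0//.
  apply: le_trans (esum_cauchy_schwarz _ _) _ => //.
  rewrite [leRHS](_ : _ = c i ^+ 2 * c i' ^+ 2); last by rewrite !expe2 muleACA.
  by rewrite lee_pmul ?esumT_ge0// => j; exact: sqre_ge0.
rewrite [RHS](_ : _ = \esum_ i \esum_ j \esum_ i' (v i j * v i' j)); last first.
  by apply: eq_esumT => i; rewrite esum_exchange.
rewrite [RHS]esum_exchange => [|i j]; last exact: esumT_ge0.
by apply: eq_esumT => j; rewrite expe2 esumM.
Qed.

(** Cauchy-Schwarz between the indicator of [A] and the sums over the fibers of
    [h], which vanish outside of [A]. *)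
Lemma esum_sqr_le_fibers (I J : choiceType) (h : I -> J) (f : I -> \bar R)
    (A : set J) (N : \bar R) :
  (forall i, 0 <= f i) -> (forall i, f i != 0 -> A (h i)) -> counting A <= N ->
  (\esum_ i f i) ^+ 2 <=
  N * \esum_ j (\esum_ i (if h i == j then f i else 0)) ^+ 2.
Proof.
move=> f0 fA AN; rewrite (esum_fiber h)//.
set D := fun j => \esum_ i (if h i == j then f i else 0).
have D0 j : 0 <= D j by apply: esumT_ge0 => i; case: ifP.
have -> : \esum_ j D j = \esum_ j ((if `[< A j >] then 1%:E else 0) * D j).
  apply: eq_esumT => j; case: asboolP => [|nAj]; first by rewrite mul1e.
  rewrite mul0e /D esum1// => i _; case: eqP => // hij.
  by apply: contra_notP nAj => /eqP/fA; rewrite hij.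
apply: le_trans (esum_cauchy_schwarz _ _) _ => // [j|]; first by case: ifP.
rewrite lee_wpmul2r ?esumT_ge0// => [j|]; first exact: sqre_ge0.
rewrite (le_trans _ AN)// (le_trans _ (esum_counting_le A))//.
apply: le_esumT => j.
by case: ifP; rewrite expe2 ?mul1e ?mul0e.
Qed.

Lemma esum_finType (I : finType) (f : I -> \bar R) : (forall i, 0 <= f i) ->
  \esum_ i f i = \sum_i f i.
Proof.
move=> f0; rewrite esum_fset//; last exact: finite_finset.
rewrite (@fsbig_fwiden _ _ _ _ (index_enum I))//.
- by move=> i _ /=; rewrite mem_index_enum.
- exact: index_enum_uniq.
- by move=> i [_] /(_ Logic.I).
Qed.

Lemma esum_ord_sqr_le m (c : 'I_m -> \bar R) : (forall i, 0 <= c i) ->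
  (\esum_ i c i) ^+ 2 <= m%:R%:E * \esum_ i c i ^+ 2.
Proof.
move=> c0; have := @esum_cauchy_schwarz _ (fun=> 1%:E) c (fun=> lee01) c0.
rewrite (@eq_esumT _ (fun i => 1%:E * c i) c) => [|i]; last by rewrite mul1e.
move=> /le_trans; apply; rewrite lee_wpmul2r//.
  by apply: esumT_ge0 => i; exact: sqre_ge0.
rewrite esum_finType// => [|i]; last exact: sqre_ge0.
rewrite (eq_bigr (fun=> 1%:E)) => [|i _]; last by rewrite expe2 mule1.
by rewrite sumEFin sumr_const card_ord.
Qed.

(** If [f] has infinite support, the sum on the left is [0] by convention. *)
Lemma fsum_le_esum (I : choiceType) (f : I -> R) : (forall i, 0 <= f i)%R ->
  (\sum_(i \in [set: I]) f i)%:E <= \esum_ i (f i)%:E.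
Proof.
move=> f0; have [fin|inf] := pselect (finite_set (f @^-1` [set~ 0%R])).
  rewrite fsbig_supp setTI -fsumEFin//.
  by apply: ereal_sup_ubound; exists (f @^-1` [set~ 0%R]).
by rewrite fsbig_dflt ?setTI// esumT_ge0// => i; rewrite lee_fin.
Qed.

Lemma fsum_esum (I : choiceType) (f : I -> R) : (forall i, 0 <= f i)%R ->
  finite_set [set i | f i != 0%R] ->
  (\sum_(i \in [set: I]) f i)%:E = \esum_ i (f i)%:E.
Proof.
move=> f0 fin; apply/eqP; rewrite eq_le fsum_le_esum//=.
have fin' : finite_set (f @^-1` [set~ 0%R]).
  by apply: sub_finite_set fin => i /eqP.
rewrite fsbig_supp setTI -fsumEFin// -esum_fset//; last first.
  by move=> i; rewrite lee_fin.
rewrite [leRHS]esum_if; apply: le_esumT => i.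
by case: asboolP => // /contrapT ->.
Qed.

End Esum.

(** * Polynomials with nonnegative coefficients *)

Section Polynomials.
Local Open Scope ereal_scope.
Variable R : realType.
Implicit Types P Q : {poly R}.

Lemma nneg_polyP P : reflect (forall i, 0 <= P`_i)%R (P \is a polyOver Num.nneg).
Proof. by apply: (iffP polyOverP) => h i; have := h i. Qed.

Lemma nneg_polyM P Q : P \is a polyOver Num.nneg -> Q \is a polyOver Num.nneg ->
  (P * Q)%R \is a polyOver Num.nneg.
Proof.
move=> /nneg_polyP P0 /nneg_polyP Q0; apply/nneg_polyP => i.
by rewrite coefM sumr_ge0// => j _; rewrite mulr_ge0.
Qed.

Lemma nneg_polyMn P n : P \is a polyOver Num.nneg ->
  (P *+ n)%R \is a polyOver Num.nneg.
Proof.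
by move=> /nneg_polyP P0; apply/nneg_polyP => i; rewrite coefMn mulrn_wge0.
Qed.

Lemma nneg_polyZ (c : R) P : (0 <= c)%R -> P \is a polyOver Num.nneg ->
  (c *: P)%R \is a polyOver Num.nneg.
Proof.
by move=> c0 /nneg_polyP P0; apply/nneg_polyP => i; rewrite coefZ mulr_ge0.
Qed.

Lemma nneg_poly_sum (I : finType) (P : I -> {poly R}) :
  (forall i, P i \is a polyOver Num.nneg) ->
  (\sum_i P i)%R \is a polyOver Num.nneg.
Proof.
move=> P0; apply/nneg_polyP => k; rewrite coef_sum sumr_ge0// => i _.
exact/nneg_polyP.
Qed.

Lemma nneg_poly_comp P Q : P \is a polyOver Num.nneg -> Q \is a polyOver Num.nneg ->
  (P \Po Q)%R \is a polyOver Num.nneg.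
Proof.
move=> /nneg_polyP P0 Q0; rewrite comp_polyE; apply: nneg_poly_sum => i.
apply: nneg_polyZ => //; elim: (nat_of_ord i) => [|n IHn].
  by apply/nneg_polyP => k; rewrite expr0 coef1 ler0n.
by rewrite exprS nneg_polyM.
Qed.

Lemma horner_nneg_ge0 P (x : R) : P \is a polyOver Num.nneg ->
  (0 <= x)%R -> (0 <= P.[x])%R.
Proof.
move=> /nneg_polyP P0 x0; rewrite horner_coef sumr_ge0// => i _.
by rewrite mulr_ge0 ?exprn_ge0.
Qed.

Lemma horner_nneg_le P (x y : R) : P \is a polyOver Num.nneg ->
  (0 <= x)%R -> (x <= y)%R -> (P.[x] <= P.[y])%R.
Proof.
move=> /nneg_polyP P0 x0 xy; rewrite !horner_coef ler_sum// => i _.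
by rewrite ler_wpM2l ?lerXn2r// nnegrE (le_trans x0).
Qed.

End Polynomials.

(** * Pairs of points up to the group *)

Lemma mulg_bij (G : groupType) (g : G) : bijective (fun h => h * g)%g.
Proof. by exists (fun h => h * g^-1)%g => h; rewrite ?mulgK ?mulgVK. Qed.

Lemma mulg_bijl (G : groupType) (g : G) : bijective (fun h => g * h)%g.
Proof. by exists (fun h => g^-1 * h)%g => h; rewrite ?mulKg ?mulVKg. Qed.

Lemma invg_bij (G : groupType) : bijective (fun g : G => g^-1)%g.
Proof. by exists (fun g => g^-1)%g => g; rewrite invgK. Qed.

Section Action.
Local Open Scope ereal_scope.
Variables (R : realType) (G : groupType) (X : metricType R) (a : isomAction G X).
Implicit Types (p q : X * X) (g h : G).

Lemma act2_1 p : act2 a 1%g p = p.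
Proof. by rewrite /act2 !iact1 -surjective_pairing. Qed.

Lemma act2M g h p : act2 a (g * h)%g p = act2 a g (act2 a h p).
Proof. by rewrite /act2 !iactM. Qed.

Lemma act2K g : cancel (act2 a g) (act2 a g^-1%g).
Proof. by move=> p; rewrite -act2M mulVg act2_1. Qed.

Lemma iactK g : cancel (a g) (a g^-1%g).
Proof. by move=> x; rewrite -iactM mulVg iact1. Qed.

Lemma iactVK g : cancel (a g^-1%g) (a g).
Proof. by move=> x; rewrite -iactM mulgV iact1. Qed.

Lemma pi_orbit2P p q :
  \pi_(orbit2 a)%qT p = \pi_(orbit2 a)%qT q <-> exists g, q = act2 a g p.
Proof.
split=> [/eqmodP/asboolP//|[g ->]].
by apply/(@eqmodP _ (orbit2_equiv a))/asboolP; exists g.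
Qed.

Lemma repr_orbit2 p : exists g, act2 a g (repr (\pi_(orbit2 a)%qT p)) = p.
Proof.
have /pi_orbit2P[g gp] : \pi_(orbit2 a)%qT (repr (\pi_(orbit2 a)%qT p)) =
    \pi_(orbit2 a)%qT p by rewrite reprK.
by exists g; rewrite -gp.
Qed.

End Action.

(** * Finite unions of sets of triples with property RD *)

Section Union.
Local Open Scope ereal_scope.
Variables (R : realType) (G : groupType) (X : metricType R) (a : isomAction G X).

Lemma convol2_ge0 (T : set (X * X * X)) phi psi p :
  (forall p, 0 <= phi p)%R -> (forall p, 0 <= psi p)%R ->
  0 <= convol2 T phi psi p.
Proof. by move=> f0 g0; apply: esum_ge0 => z _; rewrite lee_fin mulr_ge0. Qed.

Lemma convol2_bigcup_le m (T : 'I_m -> set (X * X * X)) phi psi p :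
  (forall p, 0 <= phi p)%R -> (forall p, 0 <= psi p)%R ->
  convol2 (\bigcup_i T i) phi psi p <= \esum_ i convol2 (T i) phi psi p.
Proof.
move=> f0 g0; set F := fun z => (phi (p.1, z) * psi (z, p.2))%:E.
have F0 z : 0 <= F z by rewrite lee_fin mulr_ge0.
rewrite /convol2 [leLHS]esum_if.
rewrite [leRHS](_ : _ =
    \esum_ z \esum_ i (if `[< T i (p.1, z, p.2) >] then F z else 0)); last first.
  rewrite [RHS]esum_exchange => [|z i]; last by case: ifP.
  by apply: eq_esumT => i; rewrite [LHS]esum_if.
apply: le_esumT => z; case: asboolP => [[i _ Ti]|_]; last first.
  by apply: esumT_ge0 => i; case: ifP.
by apply: le_trans (esum_term _ i); case: asboolP.
Qed.

Lemma propagation2_ge0 (phi : X * X -> R) : (0 <= propagation2 phi)%R.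
Proof.
rewrite /propagation2; set S := [set _ | _ in _].
have [hS|nS] := pselect (has_sup S); last by rewrite sup_out.
have [x [p pp _]] := hS.1; apply: le_trans (mdist_ge0 p.1 p.2) _.
by apply: sup_upper_bound => //; exists p.
Qed.

Lemma propagation2_le (phi : X * X -> R) (rho : R) : (0 <= rho)%R ->
  (forall p, phi p != 0%R -> mdist p.1 p.2 <= rho)%R ->
  (propagation2 phi <= rho)%R.
Proof.
move=> rho0 h; rewrite /propagation2.
have [->|/set0P S0] := eqVneq [set p | phi p != 0%R] set0.
  by rewrite image_set0 sup0.
by apply: ge_sup; [exact: image_nonempty|move=> _ [p pp <-]; exact: h].
Qed.

(** The convolution over the union is at most the sum of the convolutions over
    the [T i], and the square of a sum of [m] terms is at most [m] times the sum
    of their squares; hence the polynomial [\sum_i P i *+ m]. *)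
Lemma property_RD3_bigcup m (T : 'I_m -> set (X * X * X)) :
  (forall i, property_RD3 a (T i)) -> property_RD3 a (\bigcup_i T i).
Proof.
move=> TRD.
have {TRD} /choice[P TRD] : forall i, exists P : {poly R},
    P \is a polyOver Num.nneg /\ _ :=
  fun i => let: ex_intro2 P P1 P2 := TRD i in ex_intro _ P (conj P1 P2).
exists (\sum_i P i *+ m)%R.
  by apply: nneg_poly_sum => i; apply: nneg_polyMn; have [] := TRD i.
move=> r phi psi f0 g0 finv ginv ffin gfin fr.
have c0 i p : 0 <= convol2 (T i) phi psi p by exact: convol2_ge0.
have le1 : sqnorm2 a (convol2 (\bigcup_i T i) phi psi) <=
    \esum_ i (m%:R%:E * sqnorm2 a (convol2 (T i) phi psi)).
  rewrite esumZl// => [|i]; last by apply: esumT_ge0 => o; exact: sqre_ge0.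
  rewrite esum_exchange => [|i o]; last exact: sqre_ge0.
  rewrite -esumZl// => [|o]; last by apply: esumT_ge0 => i; exact: sqre_ge0.
  apply: le_esumT => o; apply: le_trans (esum_ord_sqr_le _) => //.
  by rewrite lee_sqr ?convol2_ge0 ?convol2_bigcup_le// esumT_ge0.
apply: le_trans le1 _.
set A := sqnorm2 _ _; set B := sqnorm2 _ _.
have A0 : 0 <= A by apply: esumT_ge0 => o; exact: sqre_ge0.
have B0 : 0 <= B by apply: esumT_ge0 => o; exact: sqre_ge0.
have bnd i := (TRD i).2 r phi psi f0 g0 finv ginv ffin gfin fr.
have r0 : (0 <= r)%R by apply: le_trans fr; exact: propagation2_ge0.
have P0 i : (0 <= (P i).[r])%R.
  by apply: horner_nneg_ge0 => //; have [] := TRD i.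
rewrite horner_sum -sumEFin -muleA -esum_finType => [|i]; last first.
  by rewrite lee_fin hornerMn mulrn_wge0.
rewrite -esumZr ?mule_ge0// => [|i]; last first.
  by rewrite lee_fin hornerMn mulrn_wge0.
apply: le_esumT => i; rewrite hornerMn -[((P i).[r] *+ m)%R]mulr_natl.
by rewrite EFinM -muleA lee_wpmul2l ?lee_fin// muleA.
Qed.

End Union.

(** * Sums over pairs and sums over orbits *)

Section OrbitSums.
Local Open Scope ereal_scope.
Variables (R : realType) (G : groupType) (X : metricType R) (a : isomAction G X).
Variable N : R.
Hypothesis N0 : (0 <= N)%R.
Hypothesis stab_le : forall x, counting (stabilizer a x) <= N%:E.
Implicit Types (p q : X * X) (u : X * X -> \bar R).

(** The elements taking [p] to [q] form a coset of the stabilizer of [p], which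
    lies in the stabilizer of the first point of [p]. *)
Lemma transporter_le p q :
  \esum_ g (if act2 a g p == q then 1%:E else 0) <= N%:E.
Proof.
have [[g0 <-]|nog] := pselect (exists g, act2 a g p = q); last first.
  rewrite esum1// => g _; case: eqP => // gp.
  by case: nog; exists g.
apply: le_trans (le_trans (esum_counting_le R _) (stab_le p.1)).
rewrite -(esum_bij _ (mulg_bijl g0)).
apply: le_esumT => g; rewrite act2M (can_eq (act2K a g0)).
case: asboolP; first by case: ifP.
by case: eqP => // gp []; rewrite /stabilizer /= -[in RHS]gp.
Qed.

(** Each pair is the translate of the representative of its orbit by at least
    one group element; in [esum_orbits_le], by at most [N]. *)
Lemma esum_le_orbits u : (forall p, 0 <= u p) ->
  \esum_ p u p <= \esum_ o \esum_ g u (act2 a g (repr (o : orbit2 a))).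
Proof.
move=> u0; rewrite (esum_fiber (fun p => \pi_(orbit2 a)%qT p))//.
apply: le_esumT => o; rewrite [leRHS](esum_fiber (fun g => act2 a g (repr o)))//.
apply: le_esumT => p; case: eqP => [<-|_]; last first.
  by apply: esumT_ge0 => g; case: ifP.
have [g gp] := repr_orbit2 a p.
by apply: (le_trans _ (esum_term _ g)); rewrite gp eqxx.
Qed.

Lemma esum_orbits_le u : (forall p, 0 <= u p) ->
  \esum_ o \esum_ g u (act2 a g (repr (o : orbit2 a))) <= N%:E * \esum_ p u p.
Proof.
move=> u0; rewrite [in leRHS](esum_fiber (fun p => \pi_(orbit2 a)%qT p))//.
rewrite -esumZl// => [|o]; last by apply: esumT_ge0 => p; case: ifP.
apply: le_esumT => o; rewrite [leLHS](esum_fiber (fun g => act2 a g (repr o)))//.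
rewrite -esumZl// => [|p]; last by case: ifP.
apply: le_esumT => p; case: eqP => [po|npo]; last first.
  rewrite mule0 esum1// => g _; case: eqP => // gp.
  case: npo; rewrite -gp -[RHS](reprK o).
  by apply/esym/pi_orbit2P; exists g.
apply: le_trans
  (_ : (\esum_ g (if act2 a g (repr o) == p then 1%:E else 0)) * u p <= _).
  rewrite -esumZr// => [|g]; last by case: ifP.
  by apply: le_esumT => g; case: eqP => [->|]; rewrite ?mul1e ?mul0e.
by rewrite lee_wpmul2r// transporter_le.
Qed.

End OrbitSums.

(** * Invariant functions from functions on the group *)

Section Periodization.
Local Open Scope ereal_scope.
Variables (R : realType) (G : groupType) (X : metricType R) (a : isomAction G X).
Variables (S : G -> set (X * X)) (f : G -> R).
Implicit Types p : X * X.

(** [S h] is the set of pairs of points among which [h] distributes its weight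
    [f h ^ 2]; each of them receives all of it. *)
Definition mass p : \bar R :=
  \esum_ h (if `[< S h p >] then (f h ^+ 2)%:E else 0).

Definition sqr_periodized p : \bar R := \esum_ y mass (act2 a y p).

(** The invariant function whose square is the sum of [mass] over the translates
    of [p]. *)
Definition periodized p : R := Num.sqrt (fine (sqr_periodized p)).

Lemma mass_ge0 p : 0 <= mass p.
Proof. by apply: esumT_ge0 => h; case: ifP => // _; rewrite lee_fin sqr_ge0. Qed.

Lemma sqr_periodized_ge0 p : 0 <= sqr_periodized p.
Proof. by apply: esumT_ge0 => y; exact: mass_ge0. Qed.

Lemma periodized_ge0 p : (0 <= periodized p)%R.
Proof. exact: sqrtr_ge0. Qed.

Lemma periodized_sqr p :
  sqr_periodized p \is a fin_num -> (periodized p)%:E ^+ 2 = sqr_periodized p.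
Proof.
move=> fin; rewrite -EFin_expe sqr_sqrtr ?fine_ge0 ?sqr_periodized_ge0//.
by rewrite fineK.
Qed.

Lemma sqr_periodized_act2 g p : sqr_periodized (act2 a g p) = sqr_periodized p.
Proof.
rewrite -[RHS](esum_bij _ (mulg_bij g)).
by apply: eq_esumT => y; rewrite act2M.
Qed.

Lemma invariant2_periodized : invariant2 a periodized.
Proof. by move=> g p; rewrite /periodized sqr_periodized_act2. Qed.

Lemma periodized_neq0 p : periodized p != 0%R ->
  exists y h, S h (act2 a y p) /\ f h != 0%R.
Proof.
apply: contraNP => no; rewrite /periodized (_ : sqr_periodized p = 0) ?sqrtr0//.
rewrite /sqr_periodized esum1// => y _; rewrite /mass esum1// => h _.
case: asboolP => // Sh.
have [->|fh] := eqVneq (f h) 0%R; first by rewrite expr0n.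
by case: no; exists y, h.
Qed.

Lemma finsupp2_periodized :
  finsupp f -> (forall h, f h != 0%R -> finite_set (S h)) ->
  finsupp2 a periodized.
Proof.
move=> ffin Sfin; pose U := \bigcup_(h in [set h | f h != 0%R]) S h.
have Ufin : finite_set U by apply: bigcup_finite.
apply: sub_finite_set (finite_image (fun p => \pi_(orbit2 a)%qT p) Ufin).
move=> _ [p /periodized_neq0[y [h [Sh fh]]] <-].
exists (act2 a y p); first by exists h.
by apply/esym/pi_orbit2P; exists y.
Qed.

Lemma propagation2_periodized (rho : R) : (0 <= rho)%R ->
  (forall h p, f h != 0%R -> S h p -> mdist p.1 p.2 <= rho)%R ->
  (propagation2 periodized <= rho)%R.
Proof.
move=> rho0 Srho; apply: propagation2_le => // p /periodized_neq0[y [h [Sh fh]]].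
by have := Srho _ _ fh Sh; rewrite iact_isom.
Qed.

Lemma esum_mass_le (M : R) : (0 <= M)%R ->
  (forall h, f h != 0%R -> counting (S h) <= M%:E) ->
  \esum_ p mass p <= M%:E * \esum_ h (f h ^+ 2)%:E.
Proof.
move=> M0 SM; rewrite esum_exchange => [|p h]; last first.
  by case: ifP => // _; rewrite lee_fin sqr_ge0.
rewrite -esumZl ?lee_fin// => [|h]; last by rewrite lee_fin sqr_ge0.
apply: le_esumT => h; have [->|fh] := eqVneq (f h) 0%R.
  by rewrite expr0n /= mule0 esum1// => p _; rewrite if_same.
apply: le_trans (_ : counting (S h) * (f h ^+ 2)%:E <= _); last first.
  by rewrite lee_wpmul2r ?SM// lee_fin sqr_ge0.
apply: le_trans (_ : _ <= (\esum_ p (if `[< S h p >] then 1%:E else 0))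
    * (f h ^+ 2)%:E) _; last first.
  by rewrite lee_wpmul2r ?esum_counting_le// lee_fin sqr_ge0.
rewrite -esumZr ?lee_fin ?sqr_ge0// => [|p]; last by case: ifP.
by apply: le_esumT => p; case: asboolP; rewrite ?mul1e ?mul0e.
Qed.

End Periodization.

Section Bounds.
Local Open Scope ereal_scope.
Variables (R : realType) (G : groupType) (X : metricType R) (a : isomAction G X).
Variables (S : G -> set (X * X)) (f : G -> R) (N M : R).
Hypothesis N0 : (0 <= N)%R.
Hypothesis M0 : (0 <= M)%R.
Hypothesis stab_le : forall x, counting (stabilizer a x) <= N%:E.
Hypothesis S_le : forall h, f h != 0%R -> counting (S h) <= M%:E.

Let norm2 : \bar R := \esum_ h (f h ^+ 2)%:E.

Lemma esum_sqr_periodized_le :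
  \esum_ o sqr_periodized a S f (repr (o : orbit2 a)) <= (N * M)%:E * norm2.
Proof.
apply: le_trans (esum_orbits_le N0 stab_le _) _ => [p|]; first exact: mass_ge0.
by rewrite EFinM -muleA lee_wpmul2l ?lee_fin// esum_mass_le.
Qed.

(** The value at [p] is the value at the representative of its orbit, hence one
    term of a finite sum over the orbits. *)
Lemma sqr_periodized_fin p : norm2 \is a fin_num ->
  sqr_periodized a S f p \is a fin_num.
Proof.
move=> nfin; rewrite ge0_fin_numE ?sqr_periodized_ge0//.
have [g <-] := repr_orbit2 a p; rewrite sqr_periodized_act2.
apply: le_lt_trans
  (esum_term (fun o : orbit2 a => sqr_periodized a S f (repr o)) _) _.
apply: le_lt_trans esum_sqr_periodized_le _.
by rewrite ltey_eq fin_numM.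
Qed.

Lemma sqnorm2_periodized_le : norm2 \is a fin_num ->
  sqnorm2 a (EFin \o periodized a S f) <= (N * M)%:E * norm2.
Proof.
move=> nfin; apply: le_trans _ esum_sqr_periodized_le.
by apply: le_esumT => o; rewrite -periodized_sqr ?sqr_periodized_fin.
Qed.

End Bounds.

(** * Convolution through the centroid *)

Section Centroid.
Local Open Scope ereal_scope.
Variables (R : realType) (G : groupType) (X : metricType R) (a : isomAction G X).
Variables (U : set (X * X * X)) (rc : G * G -> X * X * X).
Hypothesis Uinv : invariant3 a U.
Hypothesis rcU : forall gk, U (rc gk).
Variables (phi psi : G -> R).
Hypothesis phi0 : forall g, (0 <= phi g)%R.
Hypothesis psi0 : forall g, (0 <= psi g)%R.
Variables B C : G -> set (X * X).
Hypothesis rcB : forall g k al be ga, phi g != 0%R ->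
  rc (g, k) = (al, be, ga) -> B g (al, be).
Hypothesis rcC : forall g h al be ga, phi g != 0%R ->
  rc (g, (g * h)%g) = (al, be, ga) -> C h (act2 a g^-1%g (be, ga)).

Let F k g : \bar R := (phi g * psi (g^-1 * k)%g)%:E.

Let F0 k g : 0 <= F k g.
Proof. by rewrite lee_fin mulr_ge0. Qed.

Definition outer (t : X * X * X) : X * X := (t.1.1, t.2).

(** Fix [x] and [k].  Cauchy-Schwarz over [g] separates [phi] from [psi]: the sum
    of [phi g ^ 2] is at most the mass at [x (al, be)], whatever [k] is, and then
    [k] remains free to sum the [psi (g^-1 k) ^ 2].  With [k = g h], the relation
    [rc (g, g h) = x (al, be, ga)] puts [g^-1 x (be, ga)] in [C h], so that the
    sum over [g] and [h] is at most a sum over the translates of [(be, ga)], which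
    does not depend on [x]. *)
Lemma centroid_fiber_le al be ga :
  \esum_ x \esum_ k
    (\esum_ g (if rc (g, k) == (a x al, a x be, a x ga) then F k g else 0)) ^+ 2
  <= sqr_periodized a B phi (al, be) * sqr_periodized a C psi (be, ga).
Proof.
pose c x k g := (rc (g, k) == (a x al, a x be, a x ga)) && (phi g != 0%R).
pose P2 g := (phi g ^+ 2)%:E; pose Q2 g := (psi g ^+ 2)%:E.
have P20 g : 0 <= P2 g by rewrite lee_fin sqr_ge0.
have Q20 g : 0 <= Q2 g by rewrite lee_fin sqr_ge0.
(* The condition [phi g != 0] in [c] is kept on the side of [psi] because the
   triples [rc (g, g h)] are only controlled on the support of [phi]. *)
have CS x k :
    (\esum_ g (if rc (g, k) == (a x al, a x be, a x ga) then F k g else 0)) ^+ 2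
    <= mass B phi (act2 a x (al, be)) *
       \esum_ g (if c x k g then Q2 (g^-1 * k)%g else 0).
  pose f g : \bar R := if c x k g then (phi g)%:E else 0.
  pose f' g : \bar R := if c x k g then (psi (g^-1 * k)%g)%:E else 0.
  rewrite (@eq_esumT _ _ _ (fun g => f g * f' g)) => [|g]; last first.
    rewrite /f /f' /c /F; case: eqP => _ /=; last by rewrite mul0e.
    by have [->|] := eqVneq (phi g) 0%R; rewrite ?mul0r ?mul0e//= EFinM.
  apply: le_trans (esum_cauchy_schwarz _ _) _ => [g|g|].
  - by rewrite /f; case: ifP; rewrite ?lee_fin.
  - by rewrite /f'; case: ifP; rewrite ?lee_fin.
  rewrite lee_pmul ?esumT_ge0// => [g|g||].
  - exact: sqre_ge0.
  - exact: sqre_ge0.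
  - apply: le_esumT => g; rewrite /f /c.
    case: eqP => [rcg|_] /=; last first.
      by rewrite mul0e; case: ifP => // _; exact: P20.
    have [p0|pn0] /= := eqVneq (phi g) 0%R.
      by rewrite mul0e; case: ifP => // _; exact: P20.
    by rewrite asboolT//; exact: rcB rcg.
  - by apply: le_esumT => g; rewrite /f'; case: ifP => _ //=; rewrite mul0e.
(* The translate of [x (be, ga)] that receives the weight of [h] is the one by
   [g^-1], so the sum on the right is reindexed by inverses. *)
have Csum x : \esum_ k \esum_ g (if c x k g then Q2 (g^-1 * k)%g else 0) <=
    sqr_periodized a C psi (be, ga).
  rewrite esum_exchange => [|k g]; last by case: ifP.
  rewrite -[sqr_periodized _ _ _ _](sqr_periodized_act2 a C psi x).
  rewrite /sqr_periodized -[leRHS](esum_bij _ (@invg_bij G)).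
  apply: le_esumT => g; rewrite -[leLHS](esum_bij _ (mulg_bijl g)).
  apply: le_esumT => h; rewrite mulKg.
  rewrite /c; case: eqP => [rcg|_]/=; last first.
    by case: ifP => // _; exact: Q20.
  have [p0|pn0] := eqVneq (phi g) 0%R; first by case: ifP => // _; exact: Q20.
  by rewrite asboolT//; exact: rcC rcg.
rewrite [X in _ <= X * _]/sqr_periodized -esumZr ?sqr_periodized_ge0//
  => [|x]; last exact: mass_ge0.
apply: le_esumT => x.
apply: le_trans (_ : \esum_ k (mass B phi (act2 a x (al, be)) *
   \esum_ g (if c x k g then Q2 (g^-1 * k)%g else 0)) <= _).
  exact: le_esumT.
rewrite esumZl ?mass_ge0// => [|k]; last by apply: esumT_ge0 => g; case: ifP.
by rewrite lee_wpmul2l ?mass_ge0.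
Qed.

Hypothesis perB_fin : forall p, sqr_periodized a B phi p \is a fin_num.
Hypothesis perC_fin : forall p, sqr_periodized a C psi p \is a fin_num.

(** Splitting the sum over [g] according to the middle point [x be] of
    [rc (g, k)] writes it as a sum over [be] of vectors [v be] of
    [l^2(G x G)], indexed by [(x, k)].  Only the [be] with [(al, be, ga)] in
    [U] contribute, as [U] is invariant and contains the values of [rc]. *)
Lemma centroid_outer_le p :
  \esum_ x \esum_ k
    (\esum_ g (if outer (rc (g, k)) == act2 a x p then F k g else 0)) ^+ 2
  <= convol2 U (periodized a B phi) (periodized a C psi) p ^+ 2.
Proof.
case: p => al ga.
pose c be := if `[< U (al, be, ga) >] then
  (periodized a B phi (al, be) * periodized a C psi (be, ga))%:E else 0.
have -> : convol2 U (periodized a B phi) (periodized a C psi) (al, ga) =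
    \esum_ be c be by rewrite /convol2 [LHS]esum_if.
pose v be (z : G * G) : \bar R :=
  \esum_ g (if rc (g, z.2) == (a z.1 al, a z.1 be, a z.1 ga)
            then F z.2 g else 0).
have v0 be z : 0 <= v be z by apply: esumT_ge0 => g; case: ifP.
have split x k :
    \esum_ g (if outer (rc (g, k)) == (a x al, a x ga) then F k g else 0)
    = \esum_ be v be (x, k).
  have bx : bijective (a x) by exists (a x^-1%g); [exact: iactK|exact: iactVK].
  rewrite (esum_fiber (fun g => (rc (g, k)).1.2)) => [|g]; last by case: ifP.
  rewrite -[LHS](esum_bij _ bx); apply: eq_esumT => be; apply: eq_esumT => g.
  case: (rc (g, k)) => -[al' be'] ga'; rewrite /outer /= !xpair_eqE.
  by case: eqP => _; case: eqP => _; case: eqP.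
under eq_esum do under eq_esum do rewrite split.
rewrite (@esum_pair _ _ _ (fun x k => (\esum_ be v be (x, k)) ^+ 2))
  => [|x k]; last exact: sqre_ge0.
under eq_esum do rewrite -surjective_pairing.
apply: esum_minkowski => // be; rewrite /c.
  by case: ifP => // _; rewrite lee_fin mulr_ge0 ?periodized_ge0.
rewrite /v -(@esum_pair _ _ _ (fun x k => (\esum_ g
  (if rc (g, k) == (a x al, a x be, a x ga) then F k g else 0)) ^+ 2));
  last first.
  by move=> x k; exact: sqre_ge0.
case: asboolP => [Ut|nUt].
  rewrite EFinM expe2 muleACA -!expe2 !periodized_sqr//.
  exact: centroid_fiber_le.
rewrite esum1 ?sqre_ge0// => x _; rewrite esum1// => k _.
rewrite esum1 ?expe2 ?mul0e// => g _.
case: eqP => // rcg; case: nUt.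
move: (rcU (g, k)); rewrite rcg => /(Uinv x^-1%g).
by rewrite !iactK.
Qed.

(** For each [k] the sum over [g] is split along the at most [N] possible outer
    pairs; the sum over all pairs of [X^2] is then replaced by the larger sum
    over the translates of the representatives, where [centroid_outer_le]
    applies. *)
Lemma convol_le_sqnorm2 (N : R) (A : G -> set (X * X)) :
  (0 <= N)%R ->
  (forall g k, phi g != 0%R -> A k (outer (rc (g, k)))) ->
  (forall k, counting (A k) <= N%:E) ->
  \esum_ k (\esum_ g F k g) ^+ 2 <=
  N%:E * sqnorm2 a (convol2 U (periodized a B phi) (periodized a C psi)).
Proof.
move=> N0 rcA AN.
pose D k p := \esum_ g (if outer (rc (g, k)) == p then F k g else 0).
apply: le_trans (_ : \esum_ k (N%:E * \esum_ p D k p ^+ 2) <= _).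
  apply: le_esumT => k; apply: esum_sqr_le_fibers (AN k) => // g Fg.
  by apply: rcA; apply: contra_neq Fg => p0; rewrite /F p0 mul0r.
rewrite esumZl ?lee_fin// => [|k]; last first.
  by apply: esumT_ge0 => p; exact: sqre_ge0.
rewrite lee_wpmul2l ?lee_fin//.
rewrite esum_exchange => [|k p]; last exact: sqre_ge0.
apply: le_trans (esum_le_orbits a _) _ => [p|].
  by apply: esumT_ge0 => k; exact: sqre_ge0.
by apply: le_esumT => o; exact: centroid_outer_le.
Qed.

End Centroid.

(** * Functions on the group *)

Section Group.
Local Open Scope ereal_scope.
Variables (R : realType) (G : groupType).
Implicit Types (f phi psi : G -> R).

Lemma l2norm_sqr f :
  (l2norm f ^+ 2 = \sum_(g \in [set: G]) f g ^+ 2)%R.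
Proof. by rewrite sqr_sqrtr// fsumr_ge0// => g _; exact: sqr_ge0. Qed.

Lemma l2norm_sqr_le f : (l2norm f ^+ 2)%:E <= \esum_ g (f g ^+ 2)%:E.
Proof. by rewrite l2norm_sqr; apply: fsum_le_esum => g; exact: sqr_ge0. Qed.

Lemma l2norm_sqr_finsupp f : finsupp f ->
  (l2norm f ^+ 2)%:E = \esum_ g (f g ^+ 2)%:E.
Proof.
move=> ffin; rewrite l2norm_sqr fsum_esum// => [g|]; first exact: sqr_ge0.
by apply: sub_finite_set ffin => g /=; apply: contra_neq => ->; rewrite expr0n.
Qed.

Lemma convol_le phi psi k :
  (forall g, 0 <= phi g)%R -> (forall g, 0 <= psi g)%R ->
  (convol phi psi k)%:E <= \esum_ g (phi g * psi (g^-1 * k)%g)%:E.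
Proof. by move=> f0 g0; apply: fsum_le_esum => g; rewrite mulr_ge0. Qed.

Lemma convol_ge0 phi psi k :
  (forall g, 0 <= phi g)%R -> (forall g, 0 <= psi g)%R ->
  (0 <= convol phi psi k)%R.
Proof. by move=> f0 g0; apply: fsumr_ge0 => g _; rewrite mulr_ge0. Qed.

Lemma propagation_ge (L : G -> R) f g : finsupp f -> f g != 0%R ->
  (L g <= propagation L f)%R.
Proof.
move=> ffin fg; apply: ub_le_sup; last by exists g.
have [s suppE] := (finite_seqP _).1 ffin.
exists (\big[Num.max/0%R]_(h <- s) L h)%R => _ [h fh <-].
by apply: le_bigmax_seq => //; move: fh; rewrite suppE.
Qed.

Lemma counting_le_finite (I : choiceType) (A : set I) (M : R) :
  counting A <= M%:E -> finite_set A.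
Proof. by rewrite /counting; case: asboolP. Qed.

End Group.

(** * Proof of the theorem *)

Section RapidDecay.
Local Open Scope ereal_scope.
Variables (R : realType) (G : groupType) (X : metricType R) (a : isomAction G X).

(** A stabilizer contains [1], so it lies in the ball of radius its diameter.  The
    radius is enlarged to be positive, as properness speaks of such balls. *)
Lemma almost_free_stabilizer_le (L : G -> R) :
  almost_free a L -> proper_length L ->
  exists2 N : R, (0 <= N)%R & forall x, counting (stabilizer a x) <= N%:E.
Proof.
move=> [D hD] Lprop; pose K := [set g | (L g <= Num.max D 1)%R].
have Kfin : finite_set K by apply: Lprop; rewrite lt_max ltr01 orbT.
have cK : @counting _ R K = (fine (@counting _ R K))%:E.
  by rewrite fineK// /counting asboolT.
exists (fine (@counting _ R K)) => [|x].
  rewrite -lee_fin -cK -esum_counting//.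
  by apply: esumT_ge0 => g; case: ifP.
rewrite -cK.
have sK : stabilizer a x `<=` K.
  move=> g gx; rewrite /K /= le_max -lee_fin (le_trans _ (hD x))//.
  apply: ereal_sup_ubound; exists (1%g, g) => /=; last by rewrite invg1 mul1g.
  by split => //=; rewrite /stabilizer /= iact1.
rewrite -!esum_counting//; last exact: sub_finite_set sK Kfin.
apply: le_esumT => g; case: asboolP => [/sK Kg|_]; first by rewrite asboolT.
by case: ifP.
Qed.

(** The polynomial multiplies [P(r)], the number of outer pairs; [Q(P(r))], from
    property RD of [U] at the propagation [P(r)]; and [N P(r)] twice, from the
    norms of the two periodized functions. *)
Lemma property_RD_single (x0 : X) (U : set (X * X * X)) :
  almost_free a (orbit_length a x0) -> invariant3 a U -> property_RD3 a U ->
  relative_centroid a (orbit_length a x0) (fun _ : 'I_1 => U) ->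
  proper_length (orbit_length a x0) -> property_RD (orbit_length a x0).
Proof.
move=> hfree Uinv URD3 hrc hproper.
set L := orbit_length a x0.
have L0 g : (0 <= L g)%R by exact: mdist_ge0.
have [N N0 stab_le] := almost_free_stabilizer_le hfree hproper.
have [Q Q0 URD] := URD3.
have [rc [P [P0 rcU1 rcP]]] := hrc.
have rcU gk : U (rc gk) by have [] := rcU1 gk.
exists (P * (Q \Po P) * (N ^+ 2 *: (P * P)))%R.
  apply: nneg_polyM; first by apply: nneg_polyM => //; exact: nneg_poly_comp.
  by apply: nneg_polyZ; [exact: sqr_ge0|exact: nneg_polyM].
move=> r r0 phi psi phi0 psi0 phifin psifin phir.
have [rc1 rc2 rc3 rc4] := rcP r r0.
have Pr0 : (0 <= P.[r])%R by rewrite horner_nneg_ge0// ltW.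
have supp_le g : phi g != 0%R -> (L g <= r)%R.
  by move=> pg; apply: le_trans phir; exact: propagation_ge.
pose A k := [set p : X * X | exists g be,
  (L g <= r)%R /\ rc (g, k) = (p.1, be, p.2)].
pose B g := [set p : X * X | exists k ga, rc (g, k) = (p.1, p.2, ga)].
pose C h := [set p : X * X | exists g al be ga,
  [/\ (L g <= r)%R, rc (g, (g * h)%g) = (al, be, ga) &
      p = act2 a g^-1%g (be, ga)]].
have B_le g : phi g != 0%R -> counting (B g) <= P.[r]%:E.
  by move=> /supp_le gr; rewrite (le_trans (rc2 g))// lee_fin horner_nneg_le.
have C_le h : psi h != 0%R -> counting (C h) <= P.[r]%:E.
  by move=> _; exact: rc3.
have nphi := l2norm_sqr_finsupp phifin; have npsi := l2norm_sqr_finsupp psifin.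
have phinfin : \esum_ g (phi g ^+ 2)%:E \is a fin_num by rewrite -nphi.
have psinfin : \esum_ g (psi g ^+ 2)%:E \is a fin_num by rewrite -npsi.
pose Phi := periodized a B phi; pose Psi := periodized a C psi.
have rd : sqnorm2 a (convol2 U Phi Psi) <=
    Q.[P.[r]]%:E * sqnorm2 a (EFin \o Phi) * sqnorm2 a (EFin \o Psi).
  apply: URD.
  - by move=> p; exact: periodized_ge0.
  - by move=> p; exact: periodized_ge0.
  - exact: invariant2_periodized.
  - exact: invariant2_periodized.
  - by apply: finsupp2_periodized => // h /B_le; exact: counting_le_finite.
  - by apply: finsupp2_periodized => // h /C_le; exact: counting_le_finite.
  - apply: propagation2_periodized => // g p /supp_le gr [k [ga rck]].
    have [le1 _ _] := rc4 _ _ _ _ _ rck.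
    by rewrite (le_trans le1)// horner_nneg_le.
have conv_le : \esum_ k (\esum_ g (phi g * psi (g^-1 * k)%g)%:E) ^+ 2 <=
    P.[r]%:E * sqnorm2 a (convol2 U Phi Psi).
  apply: (@convol_le_sqnorm2 _ _ _ a _ _ Uinv rcU _ _ phi0 psi0 B C
    _ _ _ _ _ A) => //.
  - by move=> g k al be ga _ rcg; exists k, ga.
  - by move=> g h al be ga /supp_le gr rcg; exists g, al, be, ga.
  - by move=> p; exact: sqr_periodized_fin stab_le B_le _ phinfin.
  - by move=> p; exact: sqr_periodized_fin stab_le C_le _ psinfin.
  - move=> g k /supp_le gr; exists g, (rc (g, k)).1.2; split => //.
    by rewrite /outer /=; case: (rc (g, k)) => -[].
rewrite -lee_fin; apply: le_trans (l2norm_sqr_le _) _.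
apply: le_trans
  (_ : \esum_ k (\esum_ g (phi g * psi (g^-1 * k)%g)%:E) ^+ 2 <= _).
  apply: le_esumT => k.
  rewrite EFin_expe lee_sqr ?lee_fin ?convol_ge0 ?convol_le//.
  by apply: esumT_ge0 => g; rewrite lee_fin mulr_ge0.
apply: le_trans conv_le _.
have Q_ge0 : (0 <= Q.[P.[r]])%R by exact: horner_nneg_ge0.
have Phi_le := sqnorm2_periodized_le N0 Pr0 stab_le B_le phinfin.
have Psi_le := sqnorm2_periodized_le N0 Pr0 stab_le C_le psinfin.
have sqnorm2_ge0 (F : X * X -> R) : 0 <= sqnorm2 a (EFin \o F).
  by apply: esumT_ge0 => o; exact: sqre_ge0.
rewrite -nphi -npsi in Phi_le Psi_le.
apply: le_trans (_ : P.[r]%:E * (Q.[P.[r]]%:E *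
  ((N * P.[r])%:E * (l2norm phi ^+ 2)%:E) *
  ((N * P.[r])%:E * (l2norm psi ^+ 2)%:E)) <= _).
  rewrite lee_wpmul2l ?lee_fin// (le_trans rd)// lee_pmul//.
    by rewrite mule_ge0 ?lee_fin.
  by rewrite lee_wpmul2l ?lee_fin.
rewrite -!EFinM lee_fin !hornerM hornerZ hornerM horner_comp le_eqVlt.
by apply/orP; left; apply/eqP; ring.
Qed.

End RapidDecay.

Theorem theorem2p8 (R : realType) (G : groupType) (X : metricType R)
  (a : isomAction G X) (x0 : X) (m : nat) (T : 'I_m -> set (X * X * X))
  (hG : countable [set: G])
  (hfree : almost_free a (orbit_length a x0))
  (hTinv : forall i, invariant3 a (T i))
  (hTRD : forall i, property_RD3 a (T i))
  (hrc : relative_centroid a (orbit_length a x0) T)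
  (hproper : proper_length (orbit_length a x0)) :
  property_RD (orbit_length a x0).
Proof.
have rcU :
    relative_centroid a (orbit_length a x0) (fun _ : 'I_1 => \bigcup_i T i).
  have [rc [P [P0 rcT rcP]]] := hrc; exists rc, P; split=> // gk.
  by exists ord0.
apply: property_RD_single hfree _ (property_RD3_bigcup hTRD) rcU hproper.
by move=> g x y z [i _ /hTinv Tg]; exists i.
Qed.
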